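(* For $r\ge1$ let $G_r(z)=\sum_{\alpha\ne\varnothing}(K(\alpha))_r z^{|\alpha|}$, the sum being over all nonempty integer compositions, and let $T(z)=\frac{1-z}{1-2z}$. Then, as formal power series, $$G_r(z)=r!\,T(z)\sum_{p\ge1}\frac{z^{pr}}{(1-z^p)^r}.$$ If the numbers $B_r(n)$ are defined by $G_r(z)=T(z)\sum_{n\ge1}B_r(n)z^n$, then $$B_r(n)=r!\sum_{d\mid n}\binom{d-1}{r-1}.$$ Consequently, $$\lim_{n\to\infty}\mathbb E[(K_n)_r]=r!\sum_{p\ge1}\frac{1}{(2^p-1)^r}.$$
   Context: An integer composition of $n\ge1$ is an ordered sequence $\alpha=(a_1,\ldots,a_\ell)$ of integers $a_i\ge1$ with sum $n$; write $|\alpha|=n$ and let $\mathcal C_n$ be the set of compositions of $n$. The initial run of $\alpha$ is the maximal prefix $(a_1,\ldots,a_k)$ whose entries are all equal, and $K(\alpha)=k$ is the number of parts in it. For each $n\ge1$, $\alpha_n$ is uniformly distributed on $\mathcal C_n$ and $K_n=K(\alpha_n)$. $(x)_r=x(x-1)\cdots(x-r+1)$ is the falling factorial. Sums over $d\mid n$ are over positive divisors. *)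

(* Defs.v *)
From HB Require Import structures.
From mathcomp Require Import all_boot all_order all_algebra.
From mathcomp Require Import finmap.
From mathcomp Require Import all_classical all_reals all_analysis.

Set Implicit Arguments.
Unset Strict Implicit.
Unset Printing Implicit Defensive.

Import Order.TTheory GRing.Theory Num.Theory.

Local Open Scope classical_set_scope.
Local Open Scope ring_scope.

(* Formal power series. They are wrapped in a record because [nat -> R] already
   carries the pointwise ring structure, whereas the product here is the Cauchy
   product. *)
Record fps (R : Type) := Fps { fps_coef :> nat -> R }.

HB.instance Definition _ (R : Type) := gen_eqMixin (fps R).
HB.instance Definition _ (R : Type) := gen_choiceMixin (fps R).

Lemma fpsP (R : Type) (f g : fps R) : (forall n, f n = g n) <-> f = g.
Proof.
split=> [|->//]; case: f g => [f] [g] /= fg.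
by congr Fps; apply/funext.
Qed.

Section FpsZmodule.
Variable R : zmodType.
Implicit Types f g h : fps R.

Definition fps_zero : fps R := Fps (fun=> 0).
Definition fps_opp f : fps R := Fps (fun n => - f n).
Definition fps_add f g : fps R := Fps (fun n => f n + g n).

Fact fps_addA : associative fps_add.
Proof. by move=> f g h; apply/fpsP => n /=; rewrite addrA. Qed.
Fact fps_addC : commutative fps_add.
Proof. by move=> f g; apply/fpsP => n /=; rewrite addrC. Qed.
Fact fps_add0 : left_id fps_zero fps_add.
Proof. by move=> f; apply/fpsP => n /=; rewrite add0r. Qed.
Fact fps_addN : left_inverse fps_zero fps_opp fps_add.
Proof. by move=> f; apply/fpsP => n /=; rewrite addNr. Qed.

HB.instance Definition _ :=
  GRing.isZmodule.Build (fps R) fps_addA fps_addC fps_add0 fps_addN.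

End FpsZmodule.

Section FpsRing.
Variable R : comUnitRingType.
Implicit Types f g h : fps R.

Definition fps_one : fps R := Fps (fun n => (n == 0%N)%:R).
Definition fps_mul f g : fps R :=
  Fps (fun n => \sum_(i < n.+1) f i * g (n - i)%N).

Let trunc n f : {poly R} := \poly_(i < n.+1) f i.

Let coef_trunc n f k : (k <= n)%N -> (trunc n f)`_k = f k.
Proof. by move=> kn; rewrite coef_poly ltnS kn. Qed.

Let coef_trunc_mul n f g k :
  (k <= n)%N -> fps_mul f g k = (trunc n f * trunc n g)`_k.
Proof.
move=> kn; rewrite coefM /=; apply: eq_bigr => -[i /= ik] _.
rewrite ltnS in ik.
by rewrite !coef_trunc ?(leq_trans ik kn) ?(leq_trans (leq_subr i k) kn).
Qed.

Fact fps_mulC : commutative fps_mul.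
Proof.
by move=> f g; apply/fpsP => n; rewrite !(@coef_trunc_mul n)// mulrC.
Qed.

Fact fps_mulA : associative fps_mul.
Proof.
move=> f g h; apply/fpsP => n.
transitivity ((trunc n f * (trunc n g * trunc n h))`_n).
  rewrite coefM /=; apply: eq_bigr => -[i /= ik] _; rewrite ltnS in ik.
  by rewrite coef_trunc// -coef_trunc_mul ?leq_subr.
rewrite mulrA coefM /=; apply: eq_bigr => -[i /= ik] _; rewrite ltnS in ik.
by rewrite coef_trunc ?leq_subr// -coef_trunc_mul.
Qed.

Fact fps_mul1 : left_id fps_one fps_mul.
Proof.
move=> f; apply/fpsP => n /=; rewrite big_ord_recl/= mul1r subn0 big1 ?addr0//.
by move=> i _; rewrite mul0r.
Qed.

Fact fps_mulDl : left_distributive fps_mul +%R.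
Proof.
move=> f g h; apply/fpsP => n /=; rewrite -big_split/=.
by apply: eq_bigr => i _; rewrite mulrDl.
Qed.

Fact fps_oner_neq0 : fps_one != 0.
Proof.
apply/eqP => /fpsP/(_ 0%N) /= /eqP.
by rewrite oner_eq0.
Qed.

HB.instance Definition _ := GRing.Zmodule_isComNzRing.Build (fps R)
  fps_mulA fps_mulC fps_mul1 fps_mulDl fps_oner_neq0.

Definition fps_scale (a : R) f : fps R := Fps (fun n => a * f n).

Fact fps_scaleA a b f : fps_scale a (fps_scale b f) = fps_scale (a * b) f.
Proof. by apply/fpsP => n /=; rewrite mulrA. Qed.
Fact fps_scale1 : left_id 1 fps_scale.
Proof. by move=> f; apply/fpsP => n /=; rewrite mul1r. Qed.
Fact fps_scaleDr : right_distributive fps_scale +%R.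
Proof. by move=> a f g; apply/fpsP => n /=; rewrite mulrDr. Qed.
Fact fps_scaleDl f : {morph fps_scale^~ f : a b / a + b}.
Proof. by move=> a b; apply/fpsP => n /=; rewrite mulrDl. Qed.

HB.instance Definition _ := GRing.Zmodule_isLmodule.Build R (fps R)
  fps_scaleA fps_scale1 fps_scaleDr fps_scaleDl.

(* A series is invertible iff its constant coefficient is; the coefficients
   g_n of the inverse solve g_0 = 1/f_0 and
   g_n = - (1/f_0) * (f_n g_0 + ... + f_1 g_(n-1)).
   [fps_inv_upto f n] gives g_0, ..., g_n. *)
Definition fps_unit : {pred fps R} := fun f => f 0%N \is a GRing.unit.

Fixpoint fps_inv_upto f (n : nat) : nat -> R :=
  if n is m.+1 then
    fun k => if (k <= m)%N then fps_inv_upto f m k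
             else - (f 0%N)^-1 * \sum_(i < m.+1) fps_inv_upto f m i * f (m.+1 - i)%N
  else fun=> (f 0%N)^-1.

Definition fps_inv f : fps R :=
  if fps_unit f then Fps (fun n => fps_inv_upto f n n) else f.

Let fps_inv_uptoE f n k :
  (k <= n)%N -> fps_inv_upto f n k = fps_inv_upto f k k.
Proof.
elim: n => [|n IH]; first by rewrite leqn0 => /eqP->.
rewrite leq_eqVlt => /predU1P[->//|]; rewrite ltnS => kn /=.
by rewrite kn IH.
Qed.

Fact fps_mulVf : {in fps_unit, left_inverse 1 fps_inv *%R}.
Proof.
move=> f uf; have uf0 : f 0%N \is a GRing.unit by [].
rewrite /fps_inv (_ : fps_unit f = true)//.
apply/fpsP => -[|n] /=; first by rewrite big_ord1 mulVr.
rewrite big_ord_recr/= ltnn subnn [X in _ + X]mulrC mulrA mulrN mulrV// mulN1r.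
apply/eqP; rewrite subr_eq0; apply/eqP; apply: eq_bigr => -[i /= ik] _.
by rewrite ltnS in ik; rewrite fps_inv_uptoE.
Qed.

Fact fps_unitPl f g : g * f = 1 -> fps_unit f.
Proof.
move=> /fpsP/(_ 0%N); rewrite /= big_ord1 /= => gf.
by apply/unitrP; exists (g 0%N); split=> //; rewrite mulrC.
Qed.

Fact fps_inv_out : {in [predC fps_unit], fps_inv =1 id}.
Proof.
move=> f; rewrite inE => uf; rewrite /fps_inv.
by rewrite (_ : fps_unit f = false)//; apply/negbTE.
Qed.

HB.instance Definition _ := GRing.ComNzRing_hasMulInverse.Build (fps R)
  fps_mulVf fps_unitPl fps_inv_out.

Definition fpsX : fps R := Fps (fun n => (n == 1%N)%:R).

(* A family of series indexed by A is summable when each coefficient is nonzero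
   for finitely many indices only. Its sum is taken coefficientwise; the
   [\sum_(i \in A)] of fsbigop adds the finitely many nonzero terms (and is 0
   by convention for a family that is not summable). The lemmas
   [summable_compositions], [summable_multiples] and [summable_coef] below
   show that this convention is never used. *)
Definition fps_summable (I : choiceType) (A : set I) (f : I -> fps R) :=
  forall n, finite_set (A `&` [set i | f i n != 0]).

Definition fps_sum (I : choiceType) (A : set I) (f : I -> fps R) : fps R :=
  Fps (fun n => \sum_(i \in A) f i n).

End FpsRing.

Notation "''z'" := (@fpsX _) (at level 0) : ring_scope.

Definition nonempty_compositions : set (seq nat) :=
  [set s | s != [::] /\ all (leq 1) s].

Definition compositions (n : nat) : set (seq nat) :=
  [set s | s \in nonempty_compositions /\ sumn s = n].

(* Length of the longest prefix whose entries are all equal. *)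
Definition initial_run (s : seq nat) : nat :=
  \max_(k < (size s).+1 | constant (take k s)) k.

Definition G_series (R : comUnitRingType) (r : nat) : fps R :=
  fps_sum nonempty_compositions
    (fun s => (initial_run s ^_ r)%:R *: 'z ^+ sumn s).

Definition T_series (R : comUnitRingType) : fps R := (1 - 'z) / (1 - 2 *: 'z).

(* Meaningful for A finite and nonempty: [fset_set A] is empty when A is
   infinite. *)
Definition uniform_on (R : realType) d (Omega : measurableType d)
    (P : probability Omega R) (S : choiceType) (A : set S) (X : Omega -> S) :=
  forall s : S, measurable (X @^-1` [set s]) /\
    P (X @^-1` [set s]) =
      (if s \in A then (#|` fset_set A|%:R)^-1 else 0)%:E.

Lemma fpsXnE (R : comUnitRingType) n k :
  ('z ^+ n : fps R) k = (k == n)%:R.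
Proof.
elim: n k => [//|n IH] [|k]; rewrite exprS.
  by rewrite [LHS]big_ord1 /= mul0r.
rewrite [LHS]big_ord_recl/= mul0r add0r big_ord_recl/= mul1r big1 ?addr0.
  by rewrite subSS subn0 IH.
by move=> i _; rewrite mul0r.
Qed.

Lemma finite_compositions n : finite_set (compositions n).
Proof.
suff H m k : finite_set
    [set s : seq nat | (size s <= m)%N /\ all (fun a => (a <= k)%N) s].
  apply: sub_finite_set (H n n) => s /= [/set_mem[_ +] <-].
  elim: s => //= a s IH /andP[a0 /IH[sz al]]; split.
    by rewrite -(add1n (size s)) leq_add.
  rewrite leq_addr/=; apply: sub_all al => b /leq_trans; apply.
  exact: leq_addl.
elim: m => [|m IH].
  apply: sub_finite_set (finite_set1 [::]) => s /= [+ _].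
  by rewrite leqn0 size_eq0 => /eqP.
apply: (@sub_finite_set _ _ ([set [::]] `|`
    (fun p : nat * seq nat => p.1 :: p.2) @` (`I_k.+1 `*`
      [set s : seq nat | (size s <= m)%N /\ all (fun a => (a <= k)%N) s]))).
  move=> [|a s] /=; first by left.
  by move=> [sz /andP[ak al]]; right; exists (a, s).
rewrite finite_setU; split; first exact: finite_set1.
by apply/finite_image/finite_setX.
Qed.

Lemma summable_compositions (R : comUnitRingType) (c : seq nat -> R) :
  fps_summable nonempty_compositions (fun s => c s *: 'z ^+ sumn s).
Proof.
move=> n; apply: sub_finite_set (finite_compositions n) => s [sC] /= cs.
split; first exact/mem_set.
apply/eqP; apply: contraNT cs => /negbTE ns.
by rewrite /fps_scale/= fpsXnE [n == _]eq_sym ns mulr0.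
Qed.

Lemma summable_multiples (R : comUnitRingType) (r : nat) (h : nat -> fps R) :
  (1 <= r)%N ->
  fps_summable [set p : nat | (1 <= p)%N] (fun p => 'z ^+ (p * r) * h p).
Proof.
move=> r1 n; apply: sub_finite_set (finite_II n.+1) => p [/= p1] np.
rewrite ltnS leqNgt; apply: contraNN np => lt_np.
rewrite /fps_mul/= big1// => -[i /= ik] _.
rewrite fpsXnE (_ : (i == p * r)%N = false) ?mul0r//.
by apply/ltn_eqF; apply: leq_trans (leq_pmulr p r1); apply: leq_trans lt_np.
Qed.

Lemma summable_coef (R : comUnitRingType) (B : nat -> R) :
  fps_summable [set n : nat | (1 <= n)%N] (fun n => B n *: 'z ^+ n).
Proof.
move=> n; apply: sub_finite_set (finite_set1 n) => k [/= _] kn.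
apply/eqP; apply: contraNT kn => /negbTE kn.
by rewrite /fps_scale/= fpsXnE [n == _]eq_sym kn mulr0.
Qed.

(* Main.v *)
Require Import Defs.
From HB Require Import structures.
From mathcomp Require Import all_boot all_order all_algebra.
From mathcomp Require Import finmap.
From mathcomp Require Import all_classical all_reals all_analysis.
From mathcomp Require Import measurable_realfun.
Import Order.TTheory GRing.Theory Num.Theory.
Import numFieldNormedType.Exports.
Local Open Scope classical_set_scope.
Local Open Scope ring_scope.

Set Implicit Arguments.
Unset Strict Implicit.
Unset Printing Implicit Defensive.

(** Write c(m) for the number of compositions of m, with c(0) = 1, and
    b(n) for the sum of binomial(k - 1, r - 1) over the divisors k of n.

    For j >= 1, a composition of n whose initial run has at least j parts, all
    equal to p, is a block of j copies of p followed by an arbitrary, possibly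
    empty, composition of n - p j; there are c(n - p j) of them
    ([count_prefix_comps]). Since binomial(K, r) is the sum of
    binomial(j - 1, r - 1) over 1 <= j <= K, summing binomial(K, r) over the
    compositions of n gives the sum of binomial(j - 1, r - 1) c(n - p j) over
    all p, j >= 1. Grouping the pairs by d = p j turns it into the convolution
    of c with b ([sum_bin_initial_run]). As c is the coefficient sequence of T,
    this says G_r = r! T B with B the generating series of b ([G_seriesE]).

    Grouping the same pairs by p instead expresses B as the sum over p of
    z^(p r) / (1 - z^p)^r: by Pascal's rule, the coefficient of z^(p j) in that
    fraction is binomial(j - 1, r - 1) ([power_geomE], [sum_power_series]).
    Uniqueness of B is the invertibility of T.

    For the limit, c(m) = 2^(m - 1) for m >= 1 while c(0) = 1, so dividing the
    convolution by c(n) gives the exact mean ([mean_initial_run])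
      E (K_n)_r = r! (sum_(d < n) b(d) 2^(-d) + 2 b(n) 2^(-n)).
    All terms are nonnegative, so Tonelli allows B(1/2) to be summed fraction
    by fraction; each fraction contributes 1 / (2^p - 1)^r
    ([nneseries_divisor_bin_sum]). That sum is finite, so b(n) 2^(-n) tends to
    0 and the mean tends to r! B(1/2). *)

(** * An enumeration of the compositions of n *)

Definition incr_head (s : seq nat) : seq nat :=
  if s is a :: t then a.+1 :: t else [::].

(** The compositions of [m.+1]. A composition of n + 1 >= 2 arises from exactly
    one composition of n, by adding a new first part 1 or by increasing the
    first part; hence the count doubles at each step. *)
Fixpoint nonempty_comps (m : nat) : seq (seq nat) :=
  if m is m'.+1 then
    map (cons 1%N) (nonempty_comps m') ++ map incr_head (nonempty_comps m')
  else [:: [:: 1%N]].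

Definition comps (n : nat) : seq (seq nat) :=
  if n is m.+1 then nonempty_comps m else [:: [::]].

Lemma mem_nonempty_comps m s :
  (s \in nonempty_comps m) = all (leq 1) s && (sumn s == m.+1).
Proof.
elim: m s => [|m IH] s /=.
  rewrite inE; case: s => [|[|[|a]] [|[|b] s]] //=.
    by rewrite addnS andbF.
  by rewrite addnS andbF.
rewrite mem_cat; case: s => [|[|[|a]] s] /=.
- apply/negbTE; rewrite negb_or; apply/andP; split.
    by apply/negP => /mapP[].
  by apply/negP => /mapP[[|a t]]; rewrite ?IH.
- apply/negbTE; rewrite negb_or; apply/andP; split.
    by apply/negP => /mapP[].
  by apply/negP => /mapP[[|a t]]; rewrite ?IH.
- rewrite mem_map; last by move=> x y [].
  rewrite IH add1n eqSS [X in _ || X](_ : _ = false) ?orbF//.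
  by apply/negP => /mapP[[|[|a] t]]; rewrite ?IH.
- rewrite [X in X || _](_ : _ = false) /=; last by apply/negP => /mapP[].
  rewrite addSn eqSS; apply/mapP/idP => [[[|b t]]|H].
  + by rewrite IH.
  + by rewrite IH /= => /andP[/andP[_ H] H'] [-> ->]; rewrite H H'.
  + by exists (a.+1 :: s) => //; rewrite IH.
Qed.

Lemma mem_comps n s : (s \in comps n) = all (leq 1) s && (sumn s == n).
Proof.
case: n => [|m]; last exact: mem_nonempty_comps.
by rewrite inE; case: s => [|[|a] s] //=; rewrite addSn andbF.
Qed.

Lemma uniq_comps n : uniq (comps n).
Proof.
case: n => [//|m] /=; elim: m => [//|m IH] /=.
rewrite cat_uniq map_inj_uniq ?IH /=; last by move=> x y [].
rewrite map_inj_in_uniq ?IH ?andbT.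
  apply/hasPn => _ /mapP[s + ->]; rewrite mem_nonempty_comps.
  case: s => [|[|a] s]//= _; apply/negP => /mapP[] //.
move=> [|a s] [|b t]; rewrite !mem_nonempty_comps//=.
by move=> _ _ [-> ->].
Qed.

Lemma size_comps n : size (comps n) = if n is m.+1 then (2 ^ m)%N else 1%N.
Proof.
case: n => //; elim=> [//|m IH] /=.
by rewrite size_cat !size_map IH expnS mul2n addnn.
Qed.

(** * Counting by the initial run *)

Lemma leq_initial_run j s :
  (j <= initial_run s)%N = (j <= size s)%N && constant (take j s).
Proof.
have mono k : (j <= k)%N -> constant (take k s) -> constant (take j s).
  move=> jk; rewrite -(take_takel s jk).
  case: j {jk} => [|j]; first by rewrite take0.
  by case: (take k s) => [//|a t] /=; rewrite -{1}(cat_take_drop j t) all_cat => /andP[].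
apply/idP/andP => [jK|[js cj]]; last first.
  have jlt : (j < (size s).+1)%N by [].
  exact: (@leq_bigmax_cond _ (fun k : 'I__ => constant (take k s)) val (Ordinal jlt)).
apply/andP; apply: contraLR jK; rewrite -ltnNge => nH.
case: j mono nH => [|j] mono nH; first by rewrite take0 in nH.
rewrite ltnS; apply/bigmax_leqP => k ck; rewrite leqNgt.
apply: contra nH => jk; rewrite (mono k jk ck) andbT.
by apply: leq_trans jk _; rewrite -ltnS.
Qed.

Lemma initial_run_prefix j a t :
  (j.+1 <= initial_run (a :: t))%N = prefix (nseq j.+1 a) (a :: t).
Proof.
rewrite leq_initial_run /= eqxx /= prefixE size_nseq ltnS.
apply/andP/eqP => [[jt /all_pred1P]|H].
  by rewrite size_takel.
have jt : (j <= size t)%N.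
  by move: (congr1 size H); rewrite size_nseq size_take; case: ltnP => [/ltnW//|_ ->].
by split=> //; apply/all_pred1P; rewrite size_takel.
Qed.

(** The first part is the only value that a common prefix of length j >= 1 can
    repeat, so at most one term of the sum is nonzero. *)
Lemma initial_run_indicator n s j :
  s \in comps n -> (1 <= j)%N ->
  ((j <= initial_run s)%N : nat) =
    (\sum_(1 <= p < n.+1) prefix (nseq j p) s)%N.
Proof.
case: j => [//|j]; rewrite mem_comps => /andP[s1 /eqP sn] _.
case: s s1 sn => [|a t].
  by rewrite leq_initial_run /= big1.
move=> /= /andP[a0 _] sn; rewrite initial_run_prefix.
rewrite (bigD1_seq a) ?iota_uniq //=; last first.
  by rewrite mem_index_iota a0 ltnS -sn leq_addr.
rewrite eqxx /= big1 ?addn0// => p pa.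
by rewrite (negbTE pa).
Qed.

(** Deleting the prefix is a bijection onto the compositions of what remains,
    the empty one included when nothing remains. *)
Lemma count_prefix_comps n j p : (1 <= p)%N ->
  count (prefix (nseq j p)) (comps n) =
    (if (p * j <= n)%N then size (comps (n - p * j)) else 0)%N.
Proof.
move=> p1; case: ifPn => pjn.
  rewrite -size_filter -(size_map (cat (nseq j p))).
  apply/perm_size/uniq_perm.
  - exact/filter_uniq/uniq_comps.
  - rewrite map_inj_uniq ?uniq_comps// => x y /eqP.
    by rewrite eqseq_cat// eqxx => /eqP.
  move=> s; rewrite mem_filter; apply/andP/mapP => [[/prefixP[t ->]]|[t + ->]].
    rewrite !mem_comps all_cat sumn_cat sumn_nseq => /andP[/andP[_ t1] /eqP E].
    by exists t => //; rewrite mem_comps t1 /= -E addKn.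
  rewrite !mem_comps all_cat sumn_cat sumn_nseq => /andP[-> /eqP ->].
  by rewrite prefix_prefix subnKC// all_nseq p1 orbT eqxx.
apply/eqP; rewrite -leqn0 leqNgt -has_count; apply: contra pjn.
move=> /hasP[s + /prefixP[t E]]; rewrite mem_comps => /andP[_ /eqP <-].
by rewrite E sumn_cat sumn_nseq leq_addr.
Qed.

(** Hockey-stick identity; the range of j is allowed to exceed K so that the
    same range serves all compositions of n. *)
Lemma bin_sum_indicator r n K : (1 <= r)%N -> (K <= n)%N ->
  'C(K, r) = (\sum_(1 <= j < n.+1) (j <= K)%N * 'C(j.-1, r.-1))%N.
Proof.
case: r => [//|r] _ Kn.
suff -> m : (\sum_(1 <= j < m.+1) (j <= K)%N * 'C(j.-1, r))%N = 'C(minn K m, r.+1).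
  by rewrite (minn_idPl Kn).
elim: m => [|m IH]; first by rewrite big_geq// minn0.
rewrite big_nat_recr//= IH; case: (leqP m.+1 K) => mK.
  by rewrite (minn_idPr (ltnW mK)) mul1n binS.
by rewrite (minn_idPl _) ?mul0n ?addn0// -ltnS.
Qed.

Lemma sum_indicator_mul n N j : (1 <= n <= N)%N -> (1 <= j)%N ->
  (\sum_(1 <= p < N.+1) (p * j == n)%N)%N = (j %| n)%N.
Proof.
move=> /andP[n1 nN] j1; case: (boolP (j %| n)%N) => [jn|jn].
  have qn : (n %/ j <= n)%N by apply: leq_div.
  rewrite (bigD1_seq (n %/ j)%N) ?iota_uniq//=; last first.
    by rewrite mem_index_iota divn_gt0// dvdn_leq// ltnS (leq_trans qn).
  rewrite divnK// eqxx big1// => p; apply: contraNeq.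
  by rewrite eqb0 negbK => /eqP <-; rewrite mulnK.
rewrite big1// => p _; apply/eqP; rewrite eqb0; apply: contra jn.
by move=> /eqP <-; rewrite dvdn_mull.
Qed.

(** The coefficient of z^n in the series B. The case n = 0 is set apart because
    [divisors 0] is not empty, while the constant coefficient must be 0. *)
Definition divisor_bin_sum (r n : nat) : nat :=
  if n is 0 then 0%N else (\sum_(k <- divisors n) 'C(k.-1, r.-1))%N.

(** The cofactor p is kept as a second summation variable, so that the sum over
    divisors can be regrouped by j, by p, or by their product. *)
Lemma sum_divisors_pairs n N (F : nat -> nat) : (1 <= n <= N)%N ->
  (\sum_(k <- divisors n) F k =
   \sum_(1 <= j < N.+1) \sum_(1 <= p < N.+1) (p * j == n)%N * F j)%N.
Proof.
move=> /andP[n0 nN].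
rewrite (perm_big [seq j <- index_iota 1 N.+1 | j %| n]%N) /=; last first.
  apply: uniq_perm; rewrite ?divisors_uniq ?filter_uniq ?iota_uniq// => j.
  rewrite -dvdn_divisors// mem_filter mem_index_iota ltnS.
  case: (boolP (j %| n)%N) => //= jn; rewrite (dvdn_gt0 n0 jn)/=.
  by rewrite (leq_trans _ nN)// dvdn_leq.
rewrite big_filter big_mkcond/= !big_nat; apply: eq_bigr => j /andP[j1 _].
rewrite -big_distrl/= sum_indicator_mul ?n0//.
by case: ifP; rewrite ?mul1n.
Qed.

Lemma divisor_bin_sum_pairs r n N : (n <= N)%N ->
  divisor_bin_sum r n =
   (\sum_(1 <= j < N.+1) \sum_(1 <= p < N.+1) (p * j == n) * 'C(j.-1, r.-1))%N.
Proof.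
case: n => [_|n nN]; last exact: sum_divisors_pairs.
rewrite big_nat big1// => j /andP[j1 _]; rewrite big_nat big1// => p /andP[p1 _].
by rewrite muln_eq0 !gtn_eqF.
Qed.

Lemma initial_run_le_sumn n s : s \in comps n -> (initial_run s <= n)%N.
Proof.
rewrite mem_comps => /andP[s1 /eqP <-].
apply: (@leq_trans (size s)).
  by move: (leqnn (initial_run s)); rewrite leq_initial_run => /andP[].
elim: s s1 => [//|a s IH] /= /andP[a1 /IH]; rewrite -(add1n (size s)).
exact: leq_add.
Qed.

(** Both sides count triples: a pair (p, j) weighted by binomial(j - 1, r - 1)
    and a composition of n - p j. On the left p is the first part and j a length
    not exceeding that of the run; on the right d = p j. *)
Lemma sum_bin_initial_run n r : (1 <= r)%N ->
  (\sum_(s <- comps n) 'C(initial_run s, r) =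
   \sum_(d < n.+1) size (comps (n - d)) * divisor_bin_sum r d)%N.
Proof.
move=> r1.
transitivity (\sum_(1 <= j < n.+1) \sum_(1 <= p < n.+1)
    count (prefix (nseq j p)) (comps n) * 'C(j.-1, r.-1))%N.
  rewrite (eq_big_seq (fun s => \sum_(1 <= j < n.+1) \sum_(1 <= p < n.+1)
      prefix (nseq j p) s * 'C(j.-1, r.-1)))%N; last first.
    move=> s sn; rewrite (bin_sum_indicator r1 (initial_run_le_sumn sn)) !big_nat.
    apply: eq_bigr => j /andP[j1 _].
    by rewrite -big_distrl /= -initial_run_indicator.
  rewrite exchange_big/=; apply: eq_bigr => j _.
  rewrite exchange_big/=; apply: eq_bigr => p _.
  rewrite -big_distrl/= -sum1_count [in RHS]big_mkcond/=.
  by congr muln; apply: eq_bigr => s _; case: prefix.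
transitivity (\sum_(d < n.+1) \sum_(1 <= j < n.+1) \sum_(1 <= p < n.+1)
    size (comps (n - d)) * ((p * j == d) * 'C(j.-1, r.-1)))%N; last first.
  apply: eq_bigr => d _; rewrite (@divisor_bin_sum_pairs r d n); last by rewrite -ltnS.
  by rewrite big_distrr/=; apply: eq_bigr => j _; rewrite big_distrr.
rewrite [RHS]exchange_big/=; apply: eq_bigr => j _.
rewrite [RHS]exchange_big/= !big_nat; apply: eq_bigr => p /andP[p1 _].
rewrite count_prefix_comps//; case: ifPn => pjn.
  rewrite (bigD1 (Ordinal (pjn : (p * j < n.+1)%N)))//= eqxx mul1n big1 ?addn0// => d.
  by move=> /negbTE; rewrite -val_eqE/= eq_sym => ->; rewrite muln0.
rewrite mul0n big1// => d _; rewrite (_ : (p * j == d)%N = false) ?muln0//.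
by apply/negbTE; apply: contraNneq pjn => ->; rewrite -ltnS.
Qed.

(** * Formal power series *)

Section Fps.
Variable R : comUnitRingType.
Implicit Types f g : fps R.

Lemma fps_coefM f g n : (f * g) n = \sum_(i < n.+1) f i * g (n - i)%N.
Proof. by []. Qed.

Lemma fps_coefB f g n : (f - g) n = f n - g n.
Proof. by []. Qed.

Lemma fps_coefZ (a : R) f n : (a *: f) n = a * f n.
Proof. by []. Qed.

Lemma fps_coef1 n : (1 : fps R) n = (n == 0%N)%:R.
Proof. by []. Qed.

Lemma fps_scaleAl (a : R) f g : a *: (f * g) = (a *: f) * g.
Proof.
apply/fpsP => n; rewrite fps_coefZ !fps_coefM big_distrr/=.
by apply: eq_bigr => i _; rewrite mulrA.
Qed.

Lemma fps_unitE f : (f \is a GRing.unit) = (f 0%N \is a GRing.unit).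
Proof. by []. Qed.

Lemma fps_coefXnM p f n :
  ('z ^+ p * f) n = if (p <= n)%N then f (n - p)%N else 0.
Proof.
rewrite fps_coefM; case: ifPn => pn.
  rewrite (bigD1 (Ordinal (pn : (p < n.+1)%N)))//= fpsXnE eqxx mul1r.
  by rewrite big1 ?addr0// => i; rewrite -val_eqE/= fpsXnE => /negbTE ->; rewrite mul0r.
rewrite big1// => i _; rewrite fpsXnE (_ : (i == p :> nat) = false) ?mul0r//.
by apply/negbTE; apply: contraNneq pn => <-; rewrite -ltnS.
Qed.

Lemma unit_1subXn p : (1 <= p)%N -> 1 - 'z ^+ p \is a @GRing.unit (fps R).
Proof.
by move=> p1; rewrite fps_unitE fps_coefB fps_coef1 fpsXnE (ltn_eqF p1) subr0 unitr1.
Qed.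

(** 1 - 2z cancels the doubling of the number of compositions from the first
    step on; the numerator 1 - z records c(0) = c(1) = 1. *)
Lemma T_seriesE : T_series R = Fps (fun n => (size (comps n))%:R).
Proof.
have uD : 1 - 2 *: 'z \is a @GRing.unit (fps R).
  by rewrite fps_unitE fps_coefB fps_coefZ mulr0 subr0 unitr1.
apply: (mulIr uD); rewrite /T_series mulrVK//.
apply/fpsP => n; rewrite mulrBr mulr1 (mulrC _ (2 *: 'z)) -fps_scaleAl -(expr1 'z) !fps_coefB.
rewrite fps_coefZ fps_coefXnM fpsXnE fps_coef1 /=.
case: n => [|[|n]]; rewrite ?mulr0 ?subr0//=.
  by rewrite sub0r mulr1 -[2]natr1 opprD addrA subrr sub0r.
by rewrite size_cat !size_map addnn -mul2n natrM subrr.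
Qed.

Lemma unit_T_series : T_series R \is a GRing.unit.
Proof. by rewrite fps_unitE T_seriesE unitr1. Qed.

Lemma fps_sum_pos_coef (F : nat -> fps R) n :
  (forall p, (n < p)%N -> F p n = 0) ->
  fps_sum [set p : nat | (1 <= p)%N] F n = \sum_(1 <= p < n.+1) F p n.
Proof.
move=> F0; rewrite /fps_sum /= (fsbigE (index_iota 1 n.+1)) ?iota_uniq//=.
- by rewrite big_nat_cond [RHS]big_nat; apply: eq_bigl => p;
    case: (boolP (0 < p < n.+1)%N) => //= /andP[p1 _]; rewrite mem_set.
- by move=> p; rewrite /= mem_index_iota => /andP[].
- move=> p /= p1; rewrite mem_index_iota p1 ltnS/= -ltnNge; exact: F0.
Qed.

Lemma fps_sum_coef (B : nat -> R) n : (1 <= n)%N ->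
  fps_sum [set n : nat | (1 <= n)%N] (fun n => B n *: 'z ^+ n) n = B n.
Proof.
move=> n1; rewrite fps_sum_pos_coef => [|p np]; last first.
  by rewrite fps_coefZ fpsXnE ltn_eqF ?mulr0.
rewrite big_nat_recr//= big_nat big1 ?add0r => [|i /andP[_ ilt]].
  by rewrite fpsXnE eqxx mulr1.
by rewrite fpsXnE gtn_eqF ?mulr0.
Qed.

Lemma initial_run_nil : initial_run [::] = 0%N.
Proof. by apply/eqP; rewrite -leqn0 -[0%N]/(size (Nil nat)); exact: (@initial_run_le_sumn 0). Qed.

(** The empty composition, absent from the sum that defines [G_series], may be
    added because its run has length 0 and r >= 1. *)
Lemma G_series_coef r n : (1 <= r)%N ->
  G_series R r n = (r`! * \sum_(s <- comps n) 'C(initial_run s, r))%N%:R.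
Proof.
move=> r1; rewrite /G_series /fps_sum/=.
rewrite (fsbigE [seq s <- comps n | s != [::]]) ?filter_uniq ?uniq_comps//=.
- rewrite big_filter_cond natrM natr_sum big_distrr /= big_seq_cond [RHS]big_seq_cond.
  rewrite [RHS]big_mkcond/= big_mkcond /=.
  apply: eq_bigr => s _; case: (boolP (s \in comps n)) => //= sn.
  rewrite -natrM mulnC bin_ffact.
  case: (eqVneq s [::]) => [->|s0] /=.
    by rewrite initial_run_nil ffact0n; case: r r1.
  move: sn; rewrite mem_comps => /andP[s1 /eqP <-].
  by rewrite mem_set//= fpsXnE eqxx mulr1.
- by move=> s /=; rewrite mem_filter mem_comps => /and3P[].
- move=> s [s0 s1] /=; rewrite mem_filter s0 mem_comps s1 /= => /negbTE sn.
  by rewrite fpsXnE eq_sym sn mulr0.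
Qed.

(** The series z^(p r) / (1 - z^p)^r, for p >= 1, by its coefficients; see
    [power_geomE]. For r = 0 it is the constant series 1. *)
Definition power_geom (p r : nat) : fps R :=
  Fps (fun n => (if r is q.+1
                 then ((0 < n) && (p %| n)) * 'C((n %/ p).-1, q)
                 else n == 0 : nat)%N%:R).

(** Pascal's rule, read on coefficients: it says that multiplying the series
    for r + 1 by 1 - z^p gives z^p times the series for r. *)
Lemma power_geom_rec p r m : (1 <= p)%N ->
  power_geom p r.+1 (m + p)%N = power_geom p r.+1 m + power_geom p r m.
Proof.
move=> p1; rewrite /= addn_gt0 p1 orbT dvdn_addl// divnDr// divnn p1 addn1 /=.
case: (posnP m) => [->|m0].
  by case: r => [|r]; rewrite dvdn0 div0n add0r ?bin0// bin_small// muln0 mul0n.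
rewrite -natrD; congr (_%:R); case: (boolP (p %| m)%N) => pm /=; last first.
  by case: r => [|r]; rewrite ?(gtn_eqF m0).
have q0 : (0 < m %/ p)%N by rewrite divn_gt0// dvdn_leq.
rewrite -(prednK q0)/= !mul1n.
by case: r => [|r]; rewrite ?(gtn_eqF m0) ?bin0// mul1n binS.
Qed.

Lemma power_geom_small p r m : (m < p)%N -> power_geom p r.+1 m = 0.
Proof.
move=> mp; rewrite /=; case: (posnP m) => [->//|m0] /=.
by rewrite gtnNdvd.
Qed.

Lemma power_geomE p r : (1 <= p)%N ->
  'z ^+ (p * r) / (1 - 'z ^+ p) ^+ r = power_geom p r.
Proof.
move=> p1; have up := unit_1subXn p1; elim: r => [|r IH].
  by rewrite muln0 !expr0 divr1; apply/fpsP.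
apply: (mulIr up); rewrite mulnS exprD exprS invrM ?unitrX// mulrA mulrVK//.
rewrite -mulrA IH.
apply/fpsP => n; rewrite mulrBr mulr1 [X in _ - X]mulrC fps_coefB !fps_coefXnM.
case: leqP => [pn|np]; last by rewrite power_geom_small// subr0.
by rewrite -{2}(subnK pn) power_geom_rec// [RHS]addrC addrA addNr add0r.
Qed.

(** Here the pairs (p, j) with p j = n are grouped by p. The index p = 0
    contributes nothing, since 0 divides only 0. *)
Lemma sum_power_geom_coef r n N : (1 <= r)%N -> (n <= N)%N ->
  \sum_(0 <= p < N.+1) power_geom p r n = (divisor_bin_sum r n)%:R.
Proof.
case: r => [//|r] _ nN; rewrite (divisor_bin_sum_pairs _ nN) -natr_sum.
congr (_%:R); rewrite big_nat_recl//= dvd0n andbC.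
have -> : ((n == 0) && (0 < n))%N = false by case: n {nN}.
rewrite mul0n add0n exchange_big/= [RHS]big_add1/= !big_nat; apply: eq_bigr => p _.
transitivity (\sum_(1 <= j < N.+1) (j * p.+1 == n) * 'C((n %/ p.+1).-1, r))%N.
  rewrite -big_distrl/=; congr muln.
  case: (posnP n) nN => [-> _|n0 nN] /=; last by rewrite sum_indicator_mul ?n0.
  by rewrite big_nat big1// => j /andP[j1 _]; rewrite muln_eq0 orbF gtn_eqF.
apply: eq_bigr => j _; rewrite (mulnC p.+1 j).
by case: eqP => [<-|]; rewrite ?mulnK// !mul0n.
Qed.

Lemma sum_power_series r : (1 <= r)%N ->
  fps_sum [set p : nat | (1 <= p)%N]
    (fun p => 'z ^+ (p * r) / (1 - 'z ^+ p) ^+ r) =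
  Fps (fun n => (divisor_bin_sum r n)%:R : R).
Proof.
case: r => [//|r] _; apply/fpsP => n.
have small p : (n < p)%N -> ('z ^+ (p * r.+1) / (1 - 'z ^+ p) ^+ r.+1 : fps R) n = 0.
  by move=> np; rewrite power_geomE ?power_geom_small//; case: p np.
rewrite (fps_sum_pos_coef small) [RHS]/= -(@sum_power_geom_coef _ _ n)// [RHS]big_nat_recl//.
rewrite [X in X + _](_ : _ = 0) ?add0r; last by rewrite /= dvd0n andbC; case: (n) => [|m]; rewrite mul0n.
rewrite big_add1/= !big_nat; apply: eq_bigr => p _.
exact: (congr1 (fun f : fps R => f n) (@power_geomE p.+1 r.+1 isT)).
Qed.

Lemma G_seriesE r : (1 <= r)%N ->
  G_series R r = (r`!)%:R *: (T_series R * Fps (fun n => (divisor_bin_sum r n)%:R)).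
Proof.
move=> r1; apply/fpsP => n; rewrite G_series_coef// sum_bin_initial_run//.
rewrite natrM fps_coefZ mulrC [in RHS]mulrC T_seriesE; congr (_ * _).
rewrite (mulrC (Fps _)) fps_coefM natr_sum; apply: eq_bigr => d _.
by rewrite natrM mulrC.
Qed.

End Fps.

(** * Evaluation at a point of the unit interval *)

Section Analysis.
Variable R : realType.

(** The recurrence on coefficients makes the partial sums satisfy
    A(N + p) = x^p (A(N) + B(N)). Since A(N) <= A(N + p), this first bounds A by
    x^p / (1 - x^p) B, hence gives convergence, and then determines the limit
    as the fixed point of L = x^p (L + v). *)
Lemma cvg_series_delayed_sum (p : nat) (x v : R) (a b : nat -> R) :
  (1 <= p)%N -> 0 <= x < 1 ->
  (forall n, 0 <= a n) -> (forall n, 0 <= b n) ->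
  (forall m, (m < p)%N -> a m = 0) ->
  (forall m, a (m + p)%N = a m + b m) ->
  series (fun n => b n * x ^+ n) @ \oo --> v ->
  series (fun n => a n * x ^+ n) @ \oo --> x ^+ p / (1 - x ^+ p) * v.
Proof.
move=> p1 /andP[x0 x1] a0 b0 asmall arec.
set B := series _ => Bv; set A := series _.
have y0 : 0 <= x ^+ p by rewrite exprn_ge0.
have y1 : x ^+ p < 1 by rewrite exprn_ilt1// -lt0n.
have mono (c : nat -> R) : (forall n, 0 <= c n) ->
    nondecreasing_seq (series (fun n => c n * x ^+ n)).
  by move=> c0; apply: nondecreasing_series => n _ _; rewrite mulr_ge0// exprn_ge0.
have Arec N : A (N + p)%N = x ^+ p * (A N + B N).
  rewrite /A /B /series/= (@big_cat_nat _ _ _ p)//= ?leq_addl//.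
  rewrite big_nat big1 ?add0r => [|m /andP[_ mp]]; last by rewrite asmall// mul0r.
  rewrite -{1}[p]add0n big_addn addnK -big_split/= big_distrr/=.
  by apply: eq_bigr => m _; rewrite arec exprD -mulrDl mulrA mulrC.
have Bub N : B N <= v.
  rewrite -(cvg_lim _ Bv)//; apply: nondecreasing_cvgn_le; first exact: mono.
  by apply/cvg_ex; exists v.
have Acvg : cvgn A.
  apply: nondecreasing_is_cvgn; first exact: mono.
  exists (x ^+ p / (1 - x ^+ p) * v) => _ [N _ <-].
  rewrite mulrAC ler_pdivlMr ?subr_gt0// mulrBr mulr1 lerBlDr.
  apply: (@le_trans _ _ (A (N + p)%N)); first exact/mono/leq_addr.
  by rewrite Arec mulrDr addrC (mulrC (A N)) lerD2r ler_wpM2l.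
have AL : A @ \oo --> limn A by exact: Acvg.
have Ashift : (fun N => A (N + p)%N) @ \oo --> limn A.
  by rewrite (cvg_shiftn p A).
have Aeq : (fun N => A (N + p)%N) @ \oo --> x ^+ p * (limn A + v).
  under eq_fun do rewrite Arec.
  by apply: cvgMr; apply: cvgD.
have E : limn A = x ^+ p * (limn A + v).
  by rewrite -[LHS](cvg_lim _ Ashift)//; exact: cvg_lim.
suff <- : limn A = x ^+ p / (1 - x ^+ p) * v by [].
have y1' : 1 - x ^+ p != 0 by rewrite subr_eq0 eq_sym lt_eqF.
apply: (mulIf y1'); rewrite mulrAC divfK// mulrBr mulr1 {1}E mulrDr.
by rewrite (mulrC (limn A)) addrAC subrr add0r.
Qed.

Lemma cvg_series_power_geom p r (x : R) : (1 <= p)%N -> 0 <= x < 1 ->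
  series (fun n => power_geom R p r n * x ^+ n) @ \oo -->
    (x ^+ p / (1 - x ^+ p)) ^+ r.
Proof.
move=> p1 x01; elim: r => [|r IH].
  rewrite expr0 -(cvg_shiftS (series _)).
  rewrite (_ : [sequence _]_n = cst 1); first exact: cvg_cst.
  apply/funext => n; rewrite /series/= big_nat_recl//= big1 ?addr0 ?mul1r//.
  by move=> i _; rewrite mul0r.
rewrite exprS.
apply: (@cvg_series_delayed_sum p x _ (power_geom R p r.+1) (power_geom R p r)) => //.
- by move=> m; exact: power_geom_small.
- by move=> m; exact: power_geom_rec.
Qed.

Lemma nneseries_EFin (u : nat -> R) (l : R) :
  series u @ \oo --> l -> (\sum_(0 <= n <oo) (u n)%:E)%E = l%:E.
Proof.
move=> ul; apply/cvg_lim => //.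
apply: cvg_EFin; first by apply: nearW => N; rewrite sumEFin.
rewrite (_ : fine \o _ = series u)//.
by apply/funext => N; rewrite /= sumEFin.
Qed.

Lemma half_power_ratio p :
  2^-1 ^+ p / (1 - 2^-1 ^+ p) = (2 ^+ p - 1)^-1 :> R.
Proof.
have y0 : 2 ^+ p != 0 :> R by rewrite expf_neq0// pnatr_eq0.
by rewrite exprVn -invfM mulrBr mulr1 divff.
Qed.

(** Tonelli: the terms are nonnegative, so the double series over n and p may be
    summed over n first. *)
Lemma nneseries_divisor_bin_sum r : (1 <= r)%N ->
  (\sum_(0 <= n <oo) ((divisor_bin_sum r n)%:R * 2^-1 ^+ n)%:E =
   \sum_(1 <= p <oo) (((2 ^+ p - 1) ^+ r)^-1)%:E :> \bar R)%E.
Proof.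
move=> r1.
have nn i j : (0 <= (power_geom R i r j * 2^-1 ^+ j)%:E)%E.
  by rewrite lee_fin mulr_ge0// exprn_ge0// invr_ge0.
transitivity (\sum_(0 <= n <oo) \sum_(0 <= p <oo) (power_geom R p r n * 2^-1 ^+ n)%:E)%E.
  apply: eq_eseriesr => n _; rewrite (@nneseries_split _ _ 0 n.+1)//.
  rewrite add0n [X in (_ + X)%E]eseries0 ?adde0 => [|p np _]; last first.
    by case: r r1 {nn} => // r _; rewrite power_geom_small// mul0r.
  by rewrite sumEFin -big_distrl/= -(@sum_power_geom_coef R r n n).
rewrite nneseries_interchange// nneseries_recl//; last first.
  by move=> p _; apply: nneseries_ge0.
rewrite [X in (X + _)%E]eseries0 ?add0e => [|n _ _]; last first.
  case: r r1 {nn} => // r _; rewrite (_ : power_geom _ _ _ _ = 0) ?mul0r//.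
  by rewrite /= dvd0n andbC; case: n.
rewrite eseries_cond [RHS]eseries_cond; apply: eq_eseriesr => p /andP[_ p1].
apply: nneseries_EFin; rewrite -exprVn -half_power_ratio//.
apply: cvg_series_power_geom => //.
by rewrite invr_ge0 ler0n invf_lt1// ltr1n.
Qed.

(** Comparison with a geometric series: 2^p - 1 >= 2^(p - 1), so the partial
    sum of the first N terms is at most 2 - 2 2^(-N). *)
Lemma nneseries_two_power_lty r : (1 <= r)%N ->
  (\sum_(1 <= p <oo) (((2 ^+ p - 1) ^+ r)^-1)%:E < +oo :> \bar R)%E.
Proof.
move=> r1.
apply: (@le_lt_trans _ _ 2%:E%E); last exact: ltry.
apply: lime_le.
  apply: is_cvg_nneseries => p p1 _; rewrite lee_fin invr_ge0 exprn_ge0// subr_ge0.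
  by rewrite exprn_ege1// ler1n.
apply: nearW => N; rewrite sumEFin lee_fin.
have h0 k : 0 <= (2^-1 : R) ^+ k by rewrite exprn_ge0// invr_ge0.
case: N => [|N]; first by rewrite big_geq.
apply: (@le_trans _ _ (2 - 2 * 2^-1 ^+ N)); last first.
  by rewrite lerBlDr lerDl mulr_ge0.
elim: N => [|N IH]; first by rewrite big_geq// expr0 mulr1 subrr.
rewrite big_nat_recr//=; apply: (le_trans (lerD IH (_ : _ <= 2^-1 ^+ N))); last first.
  by rewrite exprS mulVKf ?pnatr_eq0// mulr2n mulrDl mul1r opprD -addrA subrK.
have N1 : 1 <= 2 ^+ N :> R by rewrite exprn_ege1// ler1n.
have N2 : 2 ^+ N <= 2 ^+ N.+1 - 1 :> R.
  by rewrite exprS mulr_natl mulr2n -addrA lerDl subr_ge0.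
rewrite exprVn lef_pV2 ?posrE ?exprn_gt0//; last by rewrite (lt_le_trans _ N2)// exprn_gt0.
case: r r1 {IH} => // r _; rewrite exprS; apply: (le_trans N2).
by rewrite ler_peMr ?exprn_ege1 ?(le_trans _ N2)// (le_trans _ N1).
Qed.

End Analysis.

(** * Expectation of a function of a uniform variable *)

Section Uniform.
Context d (T : measurableType d) (R : realType) (P : probability T R).
Variables (S : countType) (r : seq S) (X : T -> S).
Hypotheses (r_uniq : uniq r) (r_neq0 : r != [::]).
Hypothesis X_uniform : uniform_on P [set` r] X.

Lemma card_fset_set_seq : #|` fset_set [set` r]| = size r.
Proof.
apply/perm_size/uniq_perm => //.
by move=> s; rewrite in_fset_set// ?mem_setE//; exact: finite_seq.
Qed.

(** The events [X = s] are measurable and there are countably many of them, so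
    every event that depends on X alone is measurable. *)
Lemma measurable_fun_discrete d' (U : measurableType d') (g : S -> U) :
  measurable_fun setT (g \o X).
Proof.
move=> _ Y mY; rewrite setTI.
rewrite (_ : _ @^-1` Y = \bigcup_s (if g s \in Y then X @^-1` [set s] else set0)).
  apply: countable_bigcupT_measurable => [|s]; first exact: countableP.
  by case: ifP => _ //; have [] := X_uniform s.
apply/seteqP; split=> w /=.
  by move=> Yw; exists (X w) => //; rewrite mem_set.
by move=> [s _]; case: ifP => // /set_mem + /= ->.
Qed.

Let D := \big[setU/set0]_(s <- r) (X @^-1` [set s]).

(** Applied to the constant function 1, this also gives P(D) = 1, hence the
    negligibility of the complement of D. *)
Let integral_support (g : S -> R) : (forall s, 0 <= g s) ->
  (\int[P]_(w in D) (g (X w))%:E = ((\sum_(s <- r) g s) / (size r)%:R)%:E)%E.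
Proof.
move=> g0; rewrite ge0_integral_bigsetU//=.
- rewrite mulr_suml -sumEFin; apply: eq_big_seq => s sr.
  have [ms Ps] := X_uniform s.
  rewrite (eq_integral (cst (g s)%:E)) => [|w /set_mem /= ->//].
  by rewrite integral_cst// [X in (_ * X)%E]Ps mem_setE sr card_fset_set_seq EFinM.
- by move=> s; have [] := X_uniform s.
- by move=> s t _ _ [w [/= -> ->]].
- have mg : measurable_fun setT (fun w => (g (X w))%:E).
    exact: (measurable_fun_discrete (fun s => (g s)%:E)).
  exact: (measurable_funS measurableT _ mg).
- by move=> w _; rewrite lee_fin.
Qed.

(** X may take values outside [r], but only with probability 0. *)
Lemma expectation_uniform (g : S -> R) : (forall s, 0 <= g s) ->
  ('E_P[fun w => g (X w)] = ((\sum_(s <- r) g s) / (size r)%:R)%:E)%E.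
Proof.
move=> g0; rewrite unlock.
have mD : measurable D.
  by apply: bigsetU_measurable => s _; have [] := X_uniform s.
have PD : P D = 1%E.
  rewrite -[LHS]mul1e -integral_cst// (integral_support (g := fun=> 1))//.
  by rewrite big_const_seq count_predT iter_addr_0 divff// pnatr_eq0 size_eq0.
rewrite (@ge0_negligible_integral _ _ _ _ _ (~` D))//=.
- by rewrite setTD setCK integral_support.
- exact: measurableC.
- exact: measurable_fun_discrete (EFin \o g).
- by move=> w _; rewrite lee_fin.
- by rewrite probability_setC// PD subee.
Qed.

End Uniform.

(** * The exact mean and its limit *)

Lemma compositionsE n : (1 <= n)%N -> compositions n = [set` comps n].
Proof.
move=> n1; apply/seteqP; split=> s /=.
  by move=> [/set_mem[_ s1] sn]; rewrite mem_comps s1 sn eqxx.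
rewrite mem_comps => /andP[s1 /eqP sn]; split=> //; apply/mem_set; split=> //.
by case: s sn {s1} => // n0; rewrite -n0 in n1.
Qed.

Section Mean.
Variable R : realType.

(** With n = m + 1: the term d = n of the convolution is the one where c(n - d) = c(0) = 1
    departs from the pattern 2^(n - d - 1) of the others: it counts double. *)
Lemma mean_initial_run r m : (1 <= r)%N ->
  (\sum_(s <- comps m.+1) (initial_run s ^_ r)%:R) / (size (comps m.+1))%:R =
  r`!%:R * (\sum_(0 <= d < m.+1) (divisor_bin_sum r d)%:R * 2^-1 ^+ d +
            2 * ((divisor_bin_sum r m.+1)%:R * 2^-1 ^+ m.+1)) :> R.
Proof.
move=> r1; have p0 k : (2 ^ k)%:R != 0 :> R by rewrite pnatr_eq0 expn_eq0.
under eq_bigr do rewrite -bin_ffact mulnC natrM.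
rewrite -big_distrr -mulrA; congr (_ * _).
rewrite -natr_sum sum_bin_initial_run// big_ord_recr subnn [size (comps 0)]/= mul1n size_comps.
rewrite natrD mulrDl natr_sum mulr_suml big_mkord.
congr (_ + _); last first.
  by rewrite mulrCA exprS mulVKf ?pnatr_eq0// natrX exprVn.
apply: eq_bigr => -[d /= dm] _; rewrite size_comps subSn//.
rewrite natrM mulrAC mulrC; congr (_ * _).
by rewrite -{2}(subnK (dm : (d <= m)%N)) expnD natrM invfM mulrA divff// mul1r natrX exprVn.
Qed.

End Mean.

Theorem proposition8p2 (R : realType) (r : nat) (hr : (1 <= r)%N) :
  [/\ G_series R r = (r`!)%:R *: (T_series R *
        fps_sum [set p : nat | (1 <= p)%N]
          (fun p => 'z ^+ (p * r) / (1 - 'z ^+ p) ^+ r)),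
      exists B : nat -> R,
        G_series R r = T_series R * fps_sum [set n : nat | (1 <= n)%N]
                                      (fun n => B n *: 'z ^+ n),
      forall B : nat -> R,
        G_series R r = T_series R * fps_sum [set n : nat | (1 <= n)%N]
                                      (fun n => B n *: 'z ^+ n) ->
        forall n, (1 <= n)%N ->
          B n = (r`!)%:R * \sum_(k <- divisors n) 'C(k.-1, r.-1)%:R
    & forall (d : nat -> measure_display)
        (Omega : forall n, measurableType (d n))
        (P : forall n, probability (Omega n) R)
        (alpha : forall n, Omega n -> seq nat),
        (forall n, (1 <= n)%N ->
           uniform_on (P n) (compositions n) (alpha n)) ->
        ('E_(P n)[fun w => (initial_run (alpha n w) ^_ r)%:R%R])%E
          @[n --> \oo] -->
        ((r`!)%:R%:E * \sum_(1 <= p <oo) (((2 ^+ p - 1) ^+ r)^-1)%:E)%E].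
Proof.
set b : fps R := Fps (fun n => (divisor_bin_sum r n)%:R).
have GT : G_series R r = T_series R * ((r`!)%:R *: b).
  by rewrite (G_seriesE R hr) (mulrC _ b) fps_scaleAl mulrC.
have scaledE : fps_sum [set n : nat | (1 <= n)%N]
    (fun n => ((r`!)%:R * b n) *: 'z ^+ n) = (r`!)%:R *: b.
  apply/fpsP => -[|n]; last exact: fps_sum_coef.
  rewrite fps_sum_pos_coef; first by rewrite big_geq//= mulr0.
  by move=> p p0; rewrite fps_coefZ fpsXnE ltn_eqF ?mulr0.
split.
- by rewrite sum_power_series// -G_seriesE.
- by exists (fun n => (r`!)%:R * b n); rewrite scaledE.
- move=> B; rewrite GT => /(mulrI (unit_T_series R)) bB n n1.
  rewrite -[LHS](fps_sum_coef B n1) -bB fps_coefZ; congr (_ * _).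
  by case: n n1 {bB} => // n _; rewrite /= natr_sum.
- move=> d Omega P alpha alphaU.
  set u := fun n => (divisor_bin_sum r n)%:R * 2^-1 ^+ n : R.
  have u0 n : 0 <= u n by rewrite mulr_ge0// exprn_ge0// invr_ge0.
  have ucvg : cvgn (series u).
    apply: nnseries_is_cvg => //.
    by rewrite (nneseries_divisor_bin_sum R hr) nneseries_two_power_lty.
  rewrite -(nneseries_divisor_bin_sum R hr) (nneseries_EFin ucvg) -EFinM.
  rewrite -(cvg_shiftS (fun n => 'E_(P n)[fun w => (initial_run (alpha n w) ^_ r)%:R%R])%E).
  rewrite (_ : [sequence _]_n = EFin \o
      (fun m => (r`!)%:R * (series u m.+1 + 2 * u m.+1))); last first.
    apply/funext => m /=; rewrite -mean_initial_run//.
    apply: (expectation_uniform (uniq_comps m.+1) _ _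
      (g := fun s => (initial_run s ^_ r)%:R)) => //.
      by rewrite -size_eq0 size_comps expn_eq0.
    by rewrite -compositionsE//; exact: alphaU.
  apply: cvg_EFin; first exact: nearW.
  apply: cvgMr; rewrite -[X in _ --> X]addr0; apply: cvgD.
    by rewrite (cvg_shiftS (series u)); exact: ucvg.
  rewrite -(mulr0 2); apply: cvgMr; rewrite (cvg_shiftS u).
  exact: cvg_series_cvg_0.
Qed.
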